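(* Let $\varepsilon_0,\mu_0,\varepsilon_1,\varepsilon_2,\mu,\omega,\Delta_t,\Delta_x>0$, and consider the FDTD model of a planar interface between two dielectrics with relative permittivities $\varepsilon_1,\varepsilon_2$ and common relative permeability $\mu$ described in the context, with numerical wavenumbers $\widetilde k_1,\widetilde k_2\in\mathbb{R}$, amplitude $E_0\neq 0$ and coefficients $\widetilde r,\widetilde t\in\mathbb{C}$. Suppose that the interface conditions (a) (continuity of the tangential magnetic field at the interface node) and (b) (discrete Faraday law at the interface node) of the context hold. Then $$ e^{i\widetilde{k}_1\Delta_x/2}+\widetilde{r}\,e^{-i\widetilde{k}_1\Delta_x/2}=\left(e^{-i\widetilde{k}_2\Delta_x/2}+i\,\frac{\Omega\mu_0\mu\Delta_x}{\eta_2}\right)\widetilde{t},\qquad \Omega=\frac{2}{\Delta_t}\sin\left(\frac{\omega\Delta_t}{2}\right). $$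
   Context: Constants: $c=1/\sqrt{\varepsilon_0\mu_0}$; Courant number $S_{\mathrm c}=c\Delta_t/\Delta_x$; for $j=1,2$ the medium $j$ has relative permittivity $\varepsilon_j$, relative permeability $\mu$, refractive index $n_{j}=\sqrt{\varepsilon_j\mu}$ and impedance $\eta_j=\sqrt{\mu_0/\varepsilon_0}\,\sqrt{\mu/\varepsilon_j}$. The numerical wavenumbers satisfy the Yee dispersion relation $\sin(\widetilde k_j\Delta_x/2)=\frac{n_j}{S_{\mathrm c}}\sin(\omega\Delta_t/2)$. Let $\xi\in\frac12\mathbb{Z}$ denote position in units of $\Delta_x$ relative to the interface ($\xi=0$; medium 1 is $\xi<0$, medium 2 is $\xi>0$) and $q\in\frac12\mathbb{Z}$ time in units of $\Delta_t$. The discrete fields are incident: $E^{(i)\,q}[\xi]=E_0e^{i(\omega q\Delta_t-\widetilde k_1\xi\Delta_x)}$, $H^{(i)\,q}[\xi]=-\frac{E_0}{\eta_1}e^{i(\omega q\Delta_t-\widetilde k_1\xi\Delta_x)}$; reflected: $E^{(r)\,q}[\xi]=\widetilde rE_0e^{i(\omega q\Delta_t+\widetilde k_1\xi\Delta_x)}$, $H^{(r)\,q}[\xi]=\widetilde r\frac{E_0}{\eta_1}e^{i(\omega q\Delta_t+\widetilde k_1\xi\Delta_x)}$; transmitted: $E^{(t)\,q}[\xi]=\widetilde tE_0e^{i(\omega q\Delta_t-\widetilde k_2\xi\Delta_x)}$, $H^{(t)\,q}[\xi]=-\widetilde t\frac{E_0}{\eta_2}e^{i(\omega q\Delta_t-\widetilde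 k_2\xi\Delta_x)}$. Dielectric interface model: the interface $\xi=0$ is a magnetic-field node of the Yee grid; the nearest electric nodes $\xi=-\frac12$ and $\xi=+\frac12$ lie strictly in media 1 and 2. Write $E^q[-\tfrac12]=E^{(i)\,q}[-\tfrac12]+E^{(r)\,q}[-\tfrac12]$ and $E^q[\tfrac12]=E^{(t)\,q}[\tfrac12]$. The interface conditions, for all $q$, are: (a) $H^{(i)\,q}[0]+H^{(r)\,q}[0]=H^{(t)\,q}[0]$, and $H^q[0]$ denotes this common value; (b) $\mu_0\mu\,\dfrac{H^{q+1/2}[0]-H^{q-1/2}[0]}{\Delta_t}=\dfrac{E^q[\frac12]-E^q[-\frac12]}{\Delta_x}$. *)

(* Defs.v *)
From Stdlib Require Import Reals.
From Coquelicot Require Import Coquelicot.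
Open Scope R_scope.

Definition Cexp (z : C) : C :=
  Cmult (RtoC (exp (Re z))) (cos (Im z), sin (Im z)).

Definition half_integer (x : R) : Prop := exists m : Z, x = IZR m / 2.

Definition light_speed (eps0 mu0 : R) : R := 1 / sqrt (eps0 * mu0).

Definition courant (eps0 mu0 dt dx : R) : R := light_speed eps0 mu0 * dt / dx.

Definition refr_index (epsj mu : R) : R := sqrt (epsj * mu).

Definition impedance (eps0 mu0 epsj mu : R) : R :=
  sqrt (mu0 / eps0) * sqrt (mu / epsj).

Definition yee_dispersion (eps0 mu0 epsj mu omega dt dx k : R) : Prop :=
  sin (k * dx / 2) =
  refr_index epsj mu / courant eps0 mu0 dt dx * sin (omega * dt / 2).

(* Fields are evaluated at time [q * dt] and position [xi * dx]; only
   half-integer [q] and [xi] are meaningful on the grid. *)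

Definition E_inc (omega dt dx k1 : R) (E0 : C) (q xi : R) : C :=
  (E0 * Cexp (Ci * RtoC (omega * q * dt - k1 * xi * dx)))%C.

Definition H_inc (omega dt dx k1 eta1 : R) (E0 : C) (q xi : R) : C :=
  (- (E0 / RtoC eta1) * Cexp (Ci * RtoC (omega * q * dt - k1 * xi * dx)))%C.

Definition E_ref (omega dt dx k1 : R) (E0 r : C) (q xi : R) : C :=
  (r * E0 * Cexp (Ci * RtoC (omega * q * dt + k1 * xi * dx)))%C.

Definition H_ref (omega dt dx k1 eta1 : R) (E0 r : C) (q xi : R) : C :=
  (r * (E0 / RtoC eta1) * Cexp (Ci * RtoC (omega * q * dt + k1 * xi * dx)))%C.

Definition E_tra (omega dt dx k2 : R) (E0 t : C) (q xi : R) : C :=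
  (t * E0 * Cexp (Ci * RtoC (omega * q * dt - k2 * xi * dx)))%C.

Definition H_tra (omega dt dx k2 eta2 : R) (E0 t : C) (q xi : R) : C :=
  (- t * (E0 / RtoC eta2) * Cexp (Ci * RtoC (omega * q * dt - k2 * xi * dx)))%C.

(* Main.v *)
(* Evaluate the discrete Faraday law at time q = 0, taking H[0] from the transmitted
   wave: its values at times 1/2 and -1/2 have a difference proportional to
   exp(i omega dt/2) - exp(-i omega dt/2) = 2 i sin(omega dt/2) = i Omega dt, and the
   common factor E0 / dx cancels from the equation. *)

Require Import Defs.
From Stdlib Require Import Reals Lra.
From Coquelicot Require Import Coquelicot.
Open Scope R_scope.

(** The exponent is purely imaginary, so the modulus factor is [exp 0 = 1]. *)
Lemma Cexp_imag (x : R) : Cexp (Ci * RtoC x) = (cos x, sin x).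
Proof.
  unfold Cexp, Ci, RtoC, Cmult; simpl.
  replace (0 * x - 1 * 0) with 0 by ring.
  replace (0 * 0 + 1 * x) with x by ring.
  rewrite exp_0; f_equal; ring.
Qed.

(** With the sign inside [RtoC], Euler's formula applies; with it outside, the phase has the shape
    used in the theorem. *)
Lemma Cexp_imag_opp (x : R) :
  Cexp (- (Ci * RtoC x)) = Cexp (Ci * RtoC (- x)).
Proof. f_equal; rewrite RtoC_opp; ring. Qed.

(** Cosine is even and sine is odd, so the real parts cancel and the imaginary parts double. *)
Lemma Cexp_imag_sub (x : R) :
  (Cexp (Ci * RtoC x) - Cexp (- (Ci * RtoC x)))%C = (Ci * RtoC (2 * sin x))%C.
Proof.
  rewrite Cexp_imag_opp, !Cexp_imag, cos_neg, sin_neg.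
  unfold Ci, RtoC, Cminus, Cplus, Copp, Cmult; simpl; f_equal; ring.
Qed.

Lemma RtoC_neq0 (x : R) : x <> 0 -> RtoC x <> 0.
Proof. intros Hx E; apply Hx, RtoC_inj, E. Qed.

Lemma impedance_pos (eps0 mu0 epsj mu : R) :
  0 < eps0 -> 0 < mu0 -> 0 < epsj -> 0 < mu -> 0 < impedance eps0 mu0 epsj mu.
Proof.
  intros; unfold impedance.
  apply Rmult_lt_0_compat; apply sqrt_lt_R0; apply Rdiv_lt_0_compat; assumption.
Qed.

Theorem theorem1
  (eps0 mu0 eps1 eps2 mu omega dt dx k1 k2 : R) (E0 r t : C) :
  0 < eps0 -> 0 < mu0 -> 0 < eps1 -> 0 < eps2 -> 0 < mu ->
  0 < omega -> 0 < dt -> 0 < dx ->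
  E0 <> RtoC 0 ->
  yee_dispersion eps0 mu0 eps1 mu omega dt dx k1 ->
  yee_dispersion eps0 mu0 eps2 mu omega dt dx k2 ->
  let eta1 := impedance eps0 mu0 eps1 mu in
  let eta2 := impedance eps0 mu0 eps2 mu in
  let Hi := H_inc omega dt dx k1 eta1 E0 in
  let Hr := H_ref omega dt dx k1 eta1 E0 r in
  let Ht := H_tra omega dt dx k2 eta2 E0 t in
  let Ei := E_inc omega dt dx k1 E0 in
  let Er := E_ref omega dt dx k1 E0 r in
  let Et := E_tra omega dt dx k2 E0 t in
  forall H0 : R -> C,
  (forall q : R, half_integer q ->
     (Hi q 0 + Hr q 0)%C = H0 q /\ Ht q 0 = H0 q) ->
  (forall q : R, half_integer q ->
     (RtoC (mu0 * mu) * ((H0 (q + 1 / 2)%R - H0 (q - 1 / 2)%R) / RtoC dt))%C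
     = ((Et q (1 / 2)%R - (Ei q (- (1 / 2))%R + Er q (- (1 / 2))%R))
          / RtoC dx)%C) ->
  let Omega := 2 / dt * sin (omega * dt / 2) in
  (Cexp (Ci * RtoC (k1 * dx / 2)) + r * Cexp (- (Ci * RtoC (k1 * dx / 2))))%C
  = ((Cexp (- (Ci * RtoC (k2 * dx / 2)))
        + Ci * RtoC (Omega * mu0 * mu * dx / eta2)) * t)%C.
Proof.
  intros Heps0 Hmu0 Heps1 Heps2 Hmu Homega Hdt Hdx HE0 _ _.
  intros eta1 eta2 Hi Hr Ht Ei Er Et H0 Hcont Hfaraday Omega.
  assert (Heta2 : 0 < eta2) by (apply impedance_pos; assumption).
  assert (Hp : H0 (0 + 1 / 2) = Ht (0 + 1 / 2) 0).
  { symmetry; apply Hcont; exists 1%Z; field. }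
  assert (Hm : H0 (0 - 1 / 2) = Ht (0 - 1 / 2) 0).
  { symmetry; apply Hcont; exists (-1)%Z; field. }
  assert (F := Hfaraday 0 ltac:(exists 0%Z; field)).
  rewrite Hp, Hm in F.
  unfold Ht, Et, Ei, Er, H_tra, E_tra, E_inc, E_ref in F.
  (* Each phase keeps a single term: H is sampled at position 0, which removes the spatial part, and
     E at time 0, which removes the temporal part. *)
  replace (omega * (0 + 1 / 2) * dt - k2 * 0 * dx)
    with (omega * dt / 2) in F by field.
  replace (omega * (0 - 1 / 2) * dt - k2 * 0 * dx)
    with (- (omega * dt / 2)) in F by field.
  replace (omega * 0 * dt - k2 * (1 / 2) * dx)
    with (- (k2 * dx / 2)) in F by field.
  replace (omega * 0 * dt - k1 * - (1 / 2) * dx)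
    with (k1 * dx / 2) in F by field.
  replace (omega * 0 * dt + k1 * - (1 / 2) * dx)
    with (- (k1 * dx / 2)) in F by field.
  rewrite <- !Cexp_imag_opp in F.
  assert (S := Cexp_imag_sub (omega * dt / 2)).
  replace (2 * sin (omega * dt / 2)) with (Omega * dt) in S
    by (unfold Omega; field; lra).
  (* Grouping [mu0 * mu] matches the factor [RtoC (mu0 * mu)] in [F]. *)
  replace (Omega * mu0 * mu * dx / eta2)
    with (Omega * (mu0 * mu) * dx / eta2) by (field; lra).
  rewrite RtoC_mult in S.
  rewrite (RtoC_div _ eta2), (RtoC_mult _ dx), (RtoC_mult Omega) by lra.
  assert (Cdt : RtoC dt <> 0) by (apply RtoC_neq0; lra).
  assert (Cdx : RtoC dx <> 0) by (apply RtoC_neq0; lra).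
  assert (Ceta2 : RtoC eta2 <> 0) by (apply RtoC_neq0; lra).
  set (m := RtoC (mu0 * mu)) in *.
  set (w := RtoC Omega) in *.
  set (cdt := RtoC dt) in *; set (cdx := RtoC dx) in *.
  set (ceta := RtoC eta2) in *.
  set (ep := Cexp (Ci * RtoC (omega * dt / 2))) in *.
  set (em := Cexp (- (Ci * RtoC (omega * dt / 2)))) in *.
  set (a1 := Cexp (Ci * RtoC (k1 * dx / 2))) in *.
  set (b1 := Cexp (- (Ci * RtoC (k1 * dx / 2)))) in *.
  set (b2 := Cexp (- (Ci * RtoC (k2 * dx / 2)))) in *.
  (* A pure identity: solving the electric difference quotient for [a1 + r * b1] makes the right
     side of [F] appear verbatim, ready to be traded for the magnetic side. *)
  assert (G : (a1 + r * b1)%C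
    = (t * b2 - cdx / E0 *
        ((t * E0 * b2 - (E0 * a1 + r * E0 * b1)) / cdx))%C)
    by (field; split; assumption).
  rewrite G, <- F.
  (* Factoring exposes [ep - em] for [S]. The minus sign of the transmitted H then meets the one in
     [G], giving [+ Ci] in the result. *)
  replace (- t * (E0 / ceta) * ep - - t * (E0 / ceta) * em)%C
    with (- t * (E0 / ceta) * (ep - em))%C by (field; assumption).
  rewrite S; field; repeat split; assumption.
Qed.
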